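(* Let $n,p$ be positive integers, $k\in\{1,\dots,p\}$, $\gamma>0$, $X\in\mathbb{R}^{n\times p}$ and $Y\in\mathbb{R}^n$. For any warm start $s_1\in S^p_k$, the outer approximation algorithm described in the context terminates after a finite number of cutting planes, and the vector $w^\star\in\mathbb{R}^p$ it returns is an optimal solution of the sparse regression problem $$\min_{w\in\mathbb{R}^p}\ \Big\{\tfrac{1}{2\gamma}\|w\|_2^2+\tfrac12\|Y-Xw\|_2^2 \ :\ \|w\|_0\le k\Big\}.$$
   Context: $\|w\|_0$ is the number of nonzero entries of $w$. $S^p_k:=\{s\in\{0,1\}^p : \sum_{j=1}^p s_j\le k\}$. Let $X_j$ be the $j$-th column of $X$ and $K_j:=X_jX_j^\top$. For $s\in[0,1]^p$ let $$c(s):=\tfrac12\,Y^\top\Big(I_n+\gamma\sum_{j=1}^p s_jK_j\Big)^{-1}Y,$$ and let $\nabla c(s)\in\mathbb{R}^p$ denote its gradient (as a row vector), whose $j$-th component is $-\tfrac{\gamma}{2}(X_j^\top\alpha)^2$ with $\alpha=(I_n+\gamma\sum_{i=1}^p s_iK_i)^{-1}Y$. For $s\in\{0,1\}^p$, $X_s$ denotes the submatrix of $X$ formed by the columns $X_j$ with $s_j=1$, and $w_s$ the subvector of $w$ with entries $w_j$, $s_j=1$. Outer approximation algorithm. Input: $Y$, $X$, $k$ (and $\gamma$). Choose $s_1\in S^p_k$ (warm start), set $\eta_1:=0$ and $t:=1$. While $\eta_t<c(s_t)$: let $(s_{t+1},\eta_{t+1})$ be any minimizer of the problem of minimizing $\eta$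 over $\eta\ge 0$ and $s\in S^p_k$ subject to the cutting planes $\eta\ge c(s_i)+\nabla c(s_i)(s-s_i)$ for all $i\in\{1,\dots,t\}$; then increase $t$ by one. When the loop ends, set $s^\star:=s_t$, set $w^\star:=0\in\mathbb{R}^p$ and then $w^\star_{s^\star}:=(I/\gamma+X_{s^\star}^\top X_{s^\star})^{-1}X_{s^\star}^\top Y$, where $I$ is the identity matrix of size equal to the number of ones in $s^\star$. Output: $s^\star$ and $w^\star$. Each pass of the loop adds one cutting plane. *)

(* Defs.v *)
From HB Require Import structures.
From mathcomp Require Import all_boot all_order all_algebra.
From mathcomp Require Import all_classical all_reals all_analysis.

Set Implicit Arguments.
Unset Strict Implicit.
Unset Printing Implicit Defensive.

Import Order.TTheory GRing.Theory Num.Theory.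
Import numFieldNormedType.Exports.

Local Open Scope classical_set_scope.
Local Open Scope ring_scope.

Definition is_minimizer (R : realType) (T : Type) (f : T -> R) (D : set T)
    (x : T) : Prop :=
  D x /\ forall y : T, D y -> f x <= f y.

(* The norm `| | that the library puts on matrices is the sup norm. *)
Definition sqnorm2 (R : realType) (m : nat) (v : 'cV[R]_m) : R :=
  \sum_i v i 0 ^+ 2.

Definition norm0 (R : realType) (m : nat) (v : 'cV[R]_m) : nat :=
  #|[set i | v i 0 != 0]%SET|.

Definition sparse_cube (R : realType) (p k : nat) : set 'cV[R]_p :=
  [set s : 'cV[R]_p |
    (forall j, s j 0 = 0 \/ s j 0 = 1) /\ \sum_j s j 0 <= k%:R].

Section SparseRegression.
Context (R : realType) (n p : nat).
Implicit Types (X : 'M[R]_(n, p)) (Y : 'cV[R]_n) (gamma : R) (s w : 'cV[R]_p).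

Definition regression_objective X Y gamma w : R :=
  (2 * gamma)^-1 * sqnorm2 w + 2^-1 * sqnorm2 (Y - X *m w).

Definition gram X (j : 'I_p) : 'M[R]_n := col j X *m (col j X)^T.

(* The formula of c makes sense for every s at which the matrix is invertible,
   in particular on a neighbourhood of [0, 1]^p when gamma > 0; elsewhere
   invmx gives a junk value. *)
Definition cost X Y gamma s : R :=
  2^-1 * (Y^T *m invmx (1%:M + gamma *: \sum_j s j 0 *: gram X j) *m Y) 0 0.

(* The derivatives are two-sided, also on the boundary of [0, 1]^p: cost is
   smooth on a neighbourhood of [0, 1]^p. *)
Definition grad_cost X Y gamma s : 'rV[R]_p :=
  \row_j 'D_(delta_mx j 0) (cost X Y gamma) s.

(* The constraint eta >= c(s_i) + grad c(s_i) (s - s_i) on (s, eta), generated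
   at the point si. *)
Definition cutting_plane X Y gamma (si : 'cV[R]_p) : set ('cV[R]_p * R) :=
  [set z : 'cV[R]_p * R |
    cost X Y gamma si + (grad_cost X Y gamma si *m (z.1 - si)) 0 0 <= z.2].

Definition master_feasible X Y gamma (k : nat) (points : set 'cV[R]_p) :
    set ('cV[R]_p * R) :=
  [set z : 'cV[R]_p * R | [/\ 0 <= z.2, sparse_cube k z.1 &
               forall si, points si -> cutting_plane X Y gamma si z]].

Definition master_solution X Y gamma (k : nat) (points : set 'cV[R]_p)
    (z : 'cV[R]_p * R) : Prop :=
  is_minimizer (fun z' : 'cV[R]_p * R => z'.2)
    (master_feasible X Y gamma k points) z.

Definition loop_guard X Y gamma (z : 'cV[R]_p * R) : Prop :=
  z.2 < cost X Y gamma z.1.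

(* Iterations are numbered from 0: z t stands for the pair
   (s_(t+1), eta_(t+1)), and visited z t is {s_1, ..., s_(t+1)}. *)
Definition visited (z : nat -> 'cV[R]_p * R) (t : nat) : set 'cV[R]_p :=
  [set si | exists2 i : nat, (i <= t)%N & si = (z i).1].

(* z 0, ..., z T are the iterates of an execution that starts at s1 and makes
   at least T passes through the loop, hence has added T cutting planes when it
   reaches z T; the values z t for t > T are irrelevant. *)
Definition oa_run X Y gamma (k : nat) s1 (T : nat)
    (z : nat -> 'cV[R]_p * R) : Prop :=
  z 0%N = (s1, 0) /\
  forall t : nat, (t < T)%N ->
    loop_guard X Y gamma (z t) /\
    master_solution X Y gamma k (visited z t) (z t.+1).

Definition support1 s : {set 'I_p} := [set j | s j 0 == 1]%SET.

(* X_s: the columns X_j with s_j = 1, in increasing order of j *)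
Definition sub_columns X s : 'M[R]_(n, #|support1 s|) :=
  colsub (@enum_val _ (mem (support1 s))) X.

Definition ridge_sub X Y gamma s : 'cV[R]_#|support1 s| :=
  let Xs := sub_columns X s in
  invmx (gamma^-1%:M + Xs^T *m Xs) *m Xs^T *m Y.

(* The vector equal to ridge_sub on the coordinates j with s_j = 1 and to 0
   elsewhere: the sum has exactly one term if s_j = 1, and none otherwise. *)
Definition ridge_output X Y gamma s : 'cV[R]_p :=
  \col_j \sum_(i < #|support1 s| | enum_val i == j) ridge_sub X Y gamma s i 0.

End SparseRegression.

(* Main.v *)
Require Import Defs.
From HB Require Import structures.
From mathcomp Require Import all_boot all_order all_algebra.
From mathcomp Require Import all_classical all_reals all_analysis.
From mathcomp Require Import ring lra.

Set Implicit Arguments.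
Unset Strict Implicit.
Unset Printing Implicit Defensive.

Import Order.TTheory GRing.Theory Num.Theory.
Import numFieldNormedType.Exports.

Local Open Scope classical_set_scope.
Local Open Scope ring_scope.

(** Write M(s) = I + gamma * \sum_j s_j X_j X_j^T and a(s) = M(s)^-1 Y, so that
    c(s) = Y^T a(s) / 2.  Everything rests on the fact that, for s >= 0, M(s)
    is positive definite and therefore
      c(s) = max_a (Y^T a - a^T M(s) a / 2),   attained at a = a(s).

    - The function being maximized is affine in s, so c is a maximum of affine
      functions, and the one for a = a(s_i) touches c at s_i
      ([cost_ge_dual]).  Its slope is the gradient of c at s_i, computed
      in [grad_costE] from the Sherman-Morrison formula ([cost_shift]).  Hence
      every cutting plane lies below c ([cutting_plane_valid]).
    - The same bound is the Fenchel dual of ridge regression on a fixed support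
      A.  Weak duality says that no w supported in A has an objective below
      c(1_A) ([regression_ge_cost]); the residual of the ridge solution is
      a(1_A), so the ridge solution attains c(1_A) ([regression_primal_sol],
      [ridge_outputE]).  Minimizing over k-sparse w is thus minimizing c over
      binary s with at most k ones.
    - For a fixed s, the best eta in the master problem is a maximum of finitely
      many numbers, and there are finitely many s; so the master problem always
      has a solution ([master_solution_exists]).
    - A binary point that comes back satisfies the cutting plane generated at
      its own first visit, which reads eta_t >= c(s_t) and contradicts the
      loop guard.  The points visited by a running loop are therefore distinct,
      and there are finitely many of them ([no_infinite_run]).
    - The master problem is a relaxation, so eta_t <= c(s) for every feasible s
      ([master_lower_bound]).  When the guard fails,
      c(s_t) <= eta_t <= c(s), hence s_t minimizes c and its ridge solution is
      optimal. *)

(** * The Euclidean inner product on column vectors *)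

Definition dot (R : pzRingType) (m : nat) (u v : 'cV[R]_m) : R :=
  (u^T *m v) 0 0.

Section DotProduct.
Context (R : comPzRingType) (m : nat).
Implicit Types (u v w : 'cV[R]_m) (a : R).

Lemma dotE u v : dot u v = \sum_i u i 0 * v i 0.
Proof. by rewrite /dot mxE; apply: eq_bigr => i _; rewrite mxE. Qed.

Lemma dotC u v : dot u v = dot v u.
Proof. by rewrite !dotE; apply: eq_bigr => i _; rewrite mulrC. Qed.

Lemma dotDr u v w : dot u (v + w) = dot u v + dot u w.
Proof. by rewrite /dot mulmxDr mxE. Qed.

Lemma dotBr u v w : dot u (v - w) = dot u v - dot u w.
Proof. by rewrite /dot mulmxBr !mxE. Qed.

Lemma dotZr u a v : dot u (a *: v) = a * dot u v.
Proof. by rewrite /dot -scalemxAr mxE. Qed.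

Lemma dot_sumr u (I : finType) (F : I -> 'cV[R]_m) :
  dot u (\sum_i F i) = \sum_i dot u (F i).
Proof. by rewrite /dot mulmx_sumr summxE. Qed.

Lemma dotBl u v w : dot (u - v) w = dot u w - dot v w.
Proof. by rewrite dotC dotBr !(dotC w). Qed.

End DotProduct.

Lemma sqnorm2E (R : realType) (m : nat) (v : 'cV[R]_m) : sqnorm2 v = dot v v.
Proof. by rewrite dotE; apply: eq_bigr => i _; rewrite expr2. Qed.

Lemma dot_ge0 (R : realType) (m : nat) (v : 'cV[R]_m) : 0 <= dot v v.
Proof. by rewrite -sqnorm2E sumr_ge0 // => i _; rewrite sqr_ge0. Qed.

Lemma dot_eq0 (R : realType) (m : nat) (v : 'cV[R]_m) : dot v v = 0 -> v = 0.
Proof.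
rewrite -sqnorm2E => /eqP; rewrite psumr_eq0 => [/allP v0|i _]; last first.
  by rewrite sqr_ge0.
apply/colP => i; rewrite mxE; apply/eqP.
by have := v0 i (mem_index_enum i); rewrite /= sqrf_eq0.
Qed.

(** * Positive definiteness and the kernel matrix *)

Lemma unitmx_ker (F : fieldType) (m : nat) (A : 'M[F]_m) :
  (forall u : 'cV[F]_m, A *m u = 0 -> u = 0) -> A \in unitmx.
Proof.
move=> kerA; rewrite -unitmx_tr -row_free_unit; apply: inj_row_free => v vA.
apply/trmx_inj; rewrite trmx0; apply: kerA.
by rewrite -[A]trmxK -trmx_mul vA trmx0.
Qed.

Section Kernel.
Context (R : realType) (n p : nat).
Variables (X : 'M[R]_(n, p)) (Y : 'cV[R]_n) (gamma : R).
Implicit Types (s : 'cV[R]_p) (u v : 'cV[R]_n).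

Definition kernel_mx s : 'M[R]_n := 1%:M + gamma *: \sum_j s j 0 *: gram X j.

Definition dual_sol s : 'cV[R]_n := invmx (kernel_mx s) *m Y.

Lemma gram_mul j v : gram X j *m v = dot (col j X) v *: col j X.
Proof. by rewrite /gram -mulmxA [_ *m v]mx11_scalar mul_mx_scalar. Qed.

Lemma kernel_mul s v :
  kernel_mx s *m v = v + gamma *: \sum_j (s j 0 * dot (col j X) v) *: col j X.
Proof.
rewrite mulmxDl mul1mx -scalemxAl mulmx_suml; congr (_ + _ *: _).
by apply: eq_bigr => j _; rewrite -scalemxAl gram_mul scalerA.
Qed.

Lemma dot_kernel s u v : dot u (kernel_mx s *m v) =
  dot u v + gamma * \sum_j s j 0 * (dot (col j X) u * dot (col j X) v).
Proof.
rewrite kernel_mul dotDr dotZr dot_sumr; congr (_ + _ * _).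
by apply: eq_bigr => j _; rewrite dotZr (dotC u); ring.
Qed.

Lemma dot_kernelC s u v :
  dot u (kernel_mx s *m v) = dot v (kernel_mx s *m u).
Proof.
rewrite !dot_kernel dotC; congr (_ + _ * _).
by apply: eq_bigr => j _; rewrite [X in _ * X]mulrC.
Qed.

Lemma costE s : cost X Y gamma s = 2^-1 * dot Y (dual_sol s).
Proof. by rewrite /cost /dot /dual_sol mulmxA. Qed.

Hypothesis gamma_gt0 : 0 < gamma.

Lemma kernel_ge s u : (forall j, 0 <= s j 0) ->
  dot u u <= dot u (kernel_mx s *m u).
Proof.
move=> s0; rewrite dot_kernel lerDl.
apply: mulr_ge0; first exact: ltW.
by apply: sumr_ge0 => j _; rewrite mulr_ge0// -expr2 sqr_ge0.
Qed.

Lemma kernel_unit s : (forall j, 0 <= s j 0) -> kernel_mx s \in unitmx.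
Proof.
move=> s0; apply: unitmx_ker => u Mu0; apply: dot_eq0; apply/eqP.
rewrite eq_le dot_ge0 andbT (le_trans (kernel_ge u s0))// Mu0.
by rewrite /dot mulmx0 mxE.
Qed.

Lemma kernel_dual_sol s : (forall j, 0 <= s j 0) ->
  kernel_mx s *m dual_sol s = Y.
Proof. by move=> s0; rewrite /dual_sol mulmxA mulmxV ?kernel_unit// mul1mx. Qed.

(** The difference of the two sides is half the M(s)-norm squared of
    a - a(s): this is the concave maximization that represents c(s). *)
Lemma cost_ge_dual s a : (forall j, 0 <= s j 0) ->
  dot Y a - 2^-1 * dot a (kernel_mx s *m a) <= cost X Y gamma s.
Proof.
move=> s0; rewrite costE; set al := dual_sol s.
have MY : kernel_mx s *m al = Y by exact: kernel_dual_sol.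
have := le_trans (dot_ge0 _) (kernel_ge (al - a) s0).
rewrite mulmxBr MY dotBr !dotBl [dot al (_ *m a)]dot_kernelC MY.
by rewrite (dotC al) (dotC a Y); lra.
Qed.

Lemma cost_ge0 s : (forall j, 0 <= s j 0) -> 0 <= cost X Y gamma s.
Proof.
move=> s0; apply: le_trans (cost_ge_dual 0 s0).
by rewrite mulmx0 /dot !mulmx0 mxE mulr0 subr0.
Qed.

(** * The gradient of the cost and the cutting planes *)

Lemma kernel_mx_shift s (h : R) j :
  kernel_mx (h *: delta_mx j 0 + s) = kernel_mx s + (gamma * h) *: gram X j.
Proof.
rewrite /kernel_mx -addrA; congr (_ + _).
rewrite -scalerA -scalerDr; congr (_ *: _).
under eq_bigr do rewrite !mxE scalerDl eqxx andbT.
rewrite big_split/= addrC; congr (_ + _).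
rewrite (bigD1 j)//= eqxx mulr1 big1 ?addr0// => i /negPf ->.
by rewrite mulr0 scale0r.
Qed.

(** Moving s along the j-th axis is a rank-one update of M(s), so the
    Sherman-Morrison formula gives the increment of c in closed form.  The point
    may leave the nonnegative orthant (h < 0 and s_j = 0), where positive
    definiteness gives nothing; the nonzero denominator is what makes the
    updated matrix invertible. *)
Lemma cost_shift s j (h : R) : (forall i, 0 <= s i 0) ->
  let q := dot (col j X) (invmx (kernel_mx s) *m col j X) in
  1 + gamma * h * q != 0 ->
  cost X Y gamma (h *: delta_mx j 0 + s) - cost X Y gamma s =
  h * (- (gamma / 2) * dot (col j X) (dual_sol s) ^+ 2 / (1 + gamma * h * q)).
Proof.
move=> s0 q d0; set x := col j X in q d0 *; set r := dot x (dual_sol s).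
set M := kernel_mx s; set b := invmx M *m x.
have uM : M \in unitmx by exact: kernel_unit.
have Mb : M *m b = x by rewrite /b mulmxA mulmxV// mul1mx.
have Ma : M *m dual_sol s = Y by exact: kernel_dual_sol.
set M' := kernel_mx (h *: delta_mx j 0 + s).
have M'E v : M' *m v = M *m v + (gamma * h * dot x v) *: x.
  by rewrite /M' kernel_mx_shift mulmxDl -scalemxAl gram_mul scalerA.
(* A kernel vector u of M' is a multiple of b with
   X_j^T u (1 + gamma h q) = 0. *)
have uM' : M' \in unitmx.
  apply: unitmx_ker => u; rewrite M'E => Mu.
  have ub : u = - (gamma * h * dot x u) *: b.
    rewrite -[LHS]mul1mx -(mulVmx uM) -mulmxA.
    rewrite -[M *m u](addrK ((gamma * h * dot x u) *: x)).
    by rewrite Mu sub0r -scaleNr -scalemxAr.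
  have : dot x u * (1 + gamma * h * q) = 0.
    by rewrite mulrDr mulr1 {1}ub dotZr -/q; ring.
  move=> /eqP; rewrite mulf_eq0 (negPf d0) orbF => /eqP xu.
  by rewrite ub xu mulr0 oppr0 scale0r.
have Yb : dot Y b = r by rewrite -Ma dotC dot_kernelC Mb dotC.
have sol : dual_sol (h *: delta_mx j 0 + s) =
    dual_sol s - (gamma * h * r / (1 + gamma * h * q)) *: b.
  apply: (can_inj (mulKmx uM')); rewrite [LHS]mulmxA mulmxV// mul1mx.
  rewrite M'E mulmxBr -scalemxAr Mb Ma dotBr dotZr -/q -/r.
  rewrite -addrA -scaleNr -scalerDl -[LHS]addr0; congr (_ + _).
  by rewrite [X in X *: _](_ : _ = 0) ?scale0r//; field.
by rewrite !costE sol dotBr dotZr Yb; field.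
Qed.

(** The closed form of the increment reduces the derivative to the continuity
    at 0 of h |-> (1 + gamma h q)^-1. *)
Lemma grad_costE s j : (forall i, 0 <= s i 0) ->
  grad_cost X Y gamma s 0 j =
  - (gamma / 2) * dot (col j X) (dual_sol s) ^+ 2.
Proof.
move=> s0; rewrite mxE /derive; apply: cvg_lim => //.
set q := dot (col j X) (invmx (kernel_mx s) *m col j X).
have den_cvg : (fun h : R => 1 + gamma * h * q) @ 0^' --> (1 : R).
  apply: cvg_within_filter.
  have : (fun h : R => 1 + gamma * h * q) @ 0 --> 1 + gamma * 0 * q.
    apply: cvgD; first exact: cvg_cst.
    by apply: cvgMr_tmp; apply: cvgMl_tmp; exact: cvg_id.
  by rewrite mulr0 mul0r addr0.
have den_neq0 : \forall h \near (0 : R)^', 1 + gamma * h * q != 0.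
  by apply: (cvgr_neq0 _ den_cvg); exact: oner_neq0.
set l : R := - (gamma / 2) * _.
have : (fun h : R => l * (1 + gamma * h * q)^-1) @ 0^' --> l * 1^-1.
  apply: cvgMl_tmp; exact: (cvgV (oner_neq0 R) den_cvg).
rewrite invr1 mulr1 => lim_l; apply: cvg_trans lim_l.
apply: near_eq_cvg; near=> h.
have h0 : h != 0 by near: h; exact: nbhs_dnbhs_neq.
have d0 : 1 + gamma * h * q != 0 by near: h.
by rewrite /= [X in _ *: X](cost_shift s0 d0) /GRing.scale/= mulKf.
Unshelve. all: by end_near. Qed.

(** Freezing a = a(si) in [cost_ge_dual] gives an affine function of s below c;
    by [grad_costE] it is the tangent of c at si. *)
Lemma cutting_plane_valid (si s : 'cV[R]_p) : (forall i, 0 <= si i 0) ->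
  (forall i, 0 <= s i 0) ->
  cutting_plane X Y gamma si (s, cost X Y gamma s).
Proof.
move=> si0 s0; rewrite /cutting_plane /=; set a := dual_sol si.
apply: le_trans (cost_ge_dual a s0).
have Ma : kernel_mx si *m a = Y by exact: kernel_dual_sol.
have : dot a (kernel_mx si *m a) = dot Y a by rewrite Ma dotC.
rewrite !dot_kernel costE -/a mxE.
set Qi := \sum_j _; set D := \sum_j _; set Q := \sum_j _.
have -> : D = - (gamma / 2) * (Q - Qi).
  rewrite /D /Q /Qi -sumrB mulr_sumr; apply: eq_bigr => j _.
  by rewrite grad_costE// !mxE -/a; ring.
lra.
Qed.

End Kernel.

(** * Sparse regression as a binary problem *)

Section Reformulation.
Context (R : realType) (n p : nat).
Variables (X : 'M[R]_(n, p)) (Y : 'cV[R]_n) (gamma : R).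
Hypothesis gamma_gt0 : 0 < gamma.
Implicit Types (s w : 'cV[R]_p) (A : {set 'I_p}).

Definition indic A : 'cV[R]_p := \col_j (j \in A)%:R.

Lemma indic_ge0 A j : 0 <= indic A j 0.
Proof. by rewrite mxE ler0n. Qed.

Lemma kernel_dual_indic A :
  kernel_mx X gamma (indic A) *m dual_sol X Y gamma (indic A) = Y.
Proof. by apply: kernel_dual_sol => // j; exact: indic_ge0. Qed.

Lemma sum_indic A : \sum_j indic A j 0 = #|A|%:R.
Proof.
under eq_bigr do rewrite mxE.
by rewrite -natr_sum -big_mkcond sum1_card.
Qed.

Lemma indic_sparse (k : nat) A : (#|A| <= k)%N -> sparse_cube k (indic A).
Proof.
move=> Ak; split=> [j|]; last by rewrite sum_indic ler_nat.
by rewrite mxE; case: (j \in A); [right|left].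
Qed.

Lemma sparse_cube_indic (k : nat) s :
  sparse_cube k s -> indic (support1 s) = s.
Proof.
move=> [s01 _]; apply/colP => j; rewrite mxE inE.
by case: (s01 j) => ->; rewrite ?eqxx// eq_sym oner_eq0.
Qed.

Lemma sparse_cube_card (k : nat) s :
  sparse_cube k s -> (#|support1 s| <= k)%N.
Proof.
move=> s_sp; case: (s_sp) => _.
by rewrite -{1}(sparse_cube_indic s_sp) sum_indic ler_nat.
Qed.

Lemma sparse_cube_ge0 (k : nat) s : sparse_cube k s -> forall j, 0 <= s j 0.
Proof. by move=> s_sp j; rewrite -(sparse_cube_indic s_sp) indic_ge0. Qed.

Lemma mulmx_sum_col (m : nat) (B : 'M[R]_(n, m)) (v : 'cV[R]_m) :
  B *m v = \sum_j v j 0 *: col j B.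
Proof.
apply/colP => i; rewrite mxE summxE; apply: eq_bigr => j _.
by rewrite !mxE mulrC.
Qed.

(** Weak duality.  With a = a(1_A), add Young's inequality for each of the two
    quadratic terms of the objective:
      |Y - X w|^2 / 2 >= a^T (Y - X w) - |a|^2 / 2, and
      w_j^2 / (2 gamma) >= w_j X_j^T a - gamma / 2 * (X_j^T a)^2 for j in A,
    together with w_j = 0 for j outside A.  The terms that contain w cancel on
    the right, and what remains is a^T Y - a^T M(1_A) a / 2 = c(1_A). *)
Lemma regression_ge_cost A w : (forall j, j \notin A -> w j 0 = 0) ->
  cost X Y gamma (indic A) <= regression_objective X Y gamma w.
Proof.
move=> wA; rewrite /regression_objective.
set a := dual_sol X Y gamma (indic A).
pose x j := dot (col j X) a.
have Ma : kernel_mx X gamma (indic A) *m a = Y by exact: kernel_dual_indic.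
have pen : \sum_j (w j 0 * x j - gamma / 2 * (indic A j 0 * x j ^+ 2))
    <= (2 * gamma)^-1 * sqnorm2 w.
  rewrite /sqnorm2 mulr_sumr; apply: ler_sum => j _; rewrite mxE.
  case: (boolP (j \in A)) => [_|/wA ->]; last first.
    by rewrite !mul0r mulr0 expr0n/= mulr0 subr0.
  rewrite mul1r -subr_ge0.
  have -> : (2 * gamma)^-1 * w j 0 ^+ 2 - (w j 0 * x j - gamma / 2 * x j ^+ 2)
     = (2 * gamma)^-1 * (w j 0 - gamma * x j) ^+ 2.
    by field; rewrite gt_eqF.
  by rewrite mulr_ge0 ?sqr_ge0// invr_ge0 mulr_ge0// ltW.
set r := Y - X *m w; have fit := dot_ge0 (r - a).
have aXw : dot a (X *m w) = \sum_j w j 0 * x j.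
  rewrite mulmx_sum_col dot_sumr; apply: eq_bigr => j _.
  by rewrite dotZr dotC.
have aMa : dot Y a = dot a a + gamma * \sum_j indic A j 0 * x j ^+ 2.
  by rewrite -{1}Ma dotC dot_kernel.
move: pen; rewrite big_split/= sumrN -mulr_sumr => pen.
have ar : dot a r = dot Y a - \sum_j w j 0 * x j by rewrite dotBr aXw dotC.
clearbody r; rewrite costE -/a (sqnorm2E r).
move: fit; rewrite dotBr !dotBl (dotC r a) ar; lra.
Qed.

(** The vector at which both Young inequalities of [regression_ge_cost] are
    equalities. *)
Definition primal_sol A : 'cV[R]_p :=
  \col_j (gamma * (indic A j 0 * dot (col j X) (dual_sol X Y gamma (indic A)))).

Lemma residual_primal_sol A :
  Y - X *m primal_sol A = dual_sol X Y gamma (indic A).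
Proof.
set a := dual_sol _ _ _ _.
have Ma : kernel_mx X gamma (indic A) *m a = Y by exact: kernel_dual_indic.
rewrite -{1}Ma kernel_mul mulmx_sum_col scaler_sumr.
under [X in _ - X]eq_bigr do rewrite mxE -scalerA.
by rewrite addrK.
Qed.

Lemma regression_primal_sol A :
  regression_objective X Y gamma (primal_sol A) = cost X Y gamma (indic A).
Proof.
rewrite /regression_objective residual_primal_sol costE.
set a := dual_sol _ _ _ _.
have Ma : kernel_mx X gamma (indic A) *m a = Y by exact: kernel_dual_indic.
rewrite -{1}Ma (dotC _ a) dot_kernel (sqnorm2E a) [RHS]mulrDr.
rewrite [LHS]addrC; congr (_ + _).
rewrite /sqnorm2 !mulr_sumr; apply: eq_bigr => j _.
rewrite !mxE -/a; case: (j \in A); rewrite ?mul0r ?mul1r.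
  by field; rewrite gt_eqF.
by rewrite !mulr0 expr0n/= !mulr0.
Qed.

Lemma ridge_matrix_unit (m : nat) (B : 'M[R]_(n, m)) :
  gamma^-1%:M + B^T *m B \in unitmx.
Proof.
apply: unitmx_ker => u Gu; apply: dot_eq0; apply/eqP.
have : dot u ((gamma^-1%:M + B^T *m B) *m u) = 0.
  by rewrite Gu /dot mulmx0 mxE.
rewrite mulmxDl mul_scalar_mx dotDr dotZr.
have -> : dot u (B^T *m B *m u) = dot (B *m u) (B *m u).
  by rewrite /dot trmx_mul !mulmxA.
move=> uG; have := dot_ge0 (B *m u); have := dot_ge0 u => u0 Bu0.
rewrite eq_le u0 andbT -(pmulr_rle0 _ (_ : 0 < gamma^-1)) ?invr_gt0//.
by rewrite -uG lerDl.
Qed.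

(** Let A be the support and a = a(1_A).  The vector v = gamma X_s^T a solves
    the normal equations: (I / gamma + X_s^T X_s) v = X_s^T (a + X_s v) and
    a + X_s v = M(1_A) a = Y.  This turns the n by n system that defines a into
    the ridge system of size #|A|. *)
Lemma ridge_outputE s :
  ridge_output X Y gamma s = primal_sol (support1 s).
Proof.
set S := support1 s; set a := dual_sol X Y gamma (indic S).
pose f j := gamma * dot (col j X) a.
pose v : 'cV[R]_#|S| := \col_i f (enum_val i).
have Ma : kernel_mx X gamma (indic S) *m a = Y by exact: kernel_dual_indic.
have Xv : a + sub_columns X s *m v = Y.
  rewrite -[RHS]Ma kernel_mul mulmx_sum_col scaler_sumr; congr (_ + _).
  transitivity (\sum_(j in S) f j *: col j X).
    rewrite [RHS]big_enum_val; apply: eq_bigr => i _; rewrite mxE.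
    by congr (_ *: _); apply/colP => l; rewrite !mxE.
  rewrite big_mkcond; apply: eq_bigr => j _; rewrite mxE.
  by rewrite scalerA; case: (j \in S); rewrite ?mul1r// mul0r mulr0 scale0r.
have ridgeE : ridge_sub X Y gamma s = v.
  rewrite /ridge_sub -Xv -mulmxA.
  apply: (can_inj (mulKmx (ridge_matrix_unit (sub_columns X s)))).
  rewrite mulKVmx ?ridge_matrix_unit// mulmxDr mulmxDl -[in RHS]mulmxA.
  congr (_ + _); rewrite mul_scalar_mx; apply/colP => i.
  rewrite !mxE mulKf ?gt_eqF//.
  by rewrite dotE; apply: eq_bigr => l _; rewrite !mxE.
apply/colP => j; rewrite !mxE.
under eq_bigr do rewrite ridgeE mxE.
rewrite -(big_enum_val_cond (pred1 j) f)/=.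
rewrite -/a; case: (boolP (j \in S)) => jS.
  rewrite mul1r (big_pred1 j)// => i /=.
  by case: eqP => [->|]; rewrite ?jS ?andbF.
rewrite mul0r mulr0 big_pred0// => i.
by case: eqP => [->|]; rewrite ?(negPf jS) ?andbF.
Qed.

Lemma norm0_primal_sol A : (norm0 (primal_sol A) <= #|A|)%N.
Proof.
apply: subset_leq_card; apply/fintype.subsetP => j; rewrite inE !mxE.
by case: (j \in A) => //; rewrite mul0r mulr0 eqxx.
Qed.

End Reformulation.

(** * The outer approximation algorithm *)

Section OuterApproximation.
Context (R : realType) (n p k : nat).
Variables (X : 'M[R]_(n, p)) (Y : 'cV[R]_n) (gamma : R) (s1 : 'cV[R]_p).
Implicit Types (s : 'cV[R]_p) (z : nat -> 'cV[R]_p * R).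

(** At a fixed binary point the least admissible eta is the maximum of 0 and of
    the cuts; a minimizer of this value over the finitely many supports of size
    at most k solves the master problem. *)
Lemma master_solution_exists z (T : nat) : exists z' : 'cV[R]_p * R,
  master_solution X Y gamma k (visited z T) z'.
Proof.
pose cut s (i : nat) := cost X Y gamma (z i).1
  + (grad_cost X Y gamma (z i).1 *m (s - (z i).1)) 0 0.
pose phi (A : {set 'I_p}) := \big[Num.max/0]_(i < T.+1) cut (indic R A) i.
have A0k : (#|(finset.set0 : {set 'I_p})| <= k)%N by rewrite cards0.
case: (@arg_minP _ _ _ finset.set0 (fun A : {set 'I_p} => #|A| <= k)%N phi A0k).
move=> A Ak A_min; exists (indic R A, phi A); split=> /=.
  split=> /=; [exact: bigmax_ge_id|exact: indic_sparse|].
  move=> _ [i iT ->]; rewrite /cutting_plane/=.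
  pose i' : 'I_T.+1 := Ordinal (iT : (i < T.+1)%N).
  exact: le_bigmax 0 (fun i : 'I_T.+1 => cut (indic R A) i) i'.
move=> [s eta] [/= eta0 s_sp s_cut].
apply: le_trans (A_min _ (sparse_cube_card s_sp)) _.
apply/bigmax_leP; split=> // i _; rewrite (sparse_cube_indic s_sp).
by apply: s_cut; exists i; rewrite // -ltnS.
Qed.

Lemma iterate_feasible z (T t : nat) : sparse_cube k s1 ->
  oa_run X Y gamma k s1 T z -> (t <= T)%N -> sparse_cube k (z t).1.
Proof.
move=> s1_sp [z0 zS]; case: t => [|t] tT; first by rewrite z0.
by have [_ [[]]] := zS t tT.
Qed.

(** At s = s_i the cut generated at s_i reads eta >= c(s_i), whatever the
    gradient is; so a second visit to s_i would violate the loop guard, and the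
    supports of the iterates inject into the finite set of subsets. *)
Lemma no_infinite_run z : sparse_cube k s1 ->
  ~ (forall T : nat, oa_run X Y gamma k s1 T z).
Proof.
move=> s1_sp run.
have z_sp t : sparse_cube k (z t).1 := iterate_feasible s1_sp (run t) (leqnn t).
have norepeat (i j : nat) : (i < j)%N -> support1 (z i).1 <> support1 (z j).1.
  case: j => // j ij /(congr1 (@indic R p)).
  rewrite !(sparse_cube_indic (z_sp _)) => zij.
  have [_ [[_ _ cuts] _]] := (run j.+1).2 j (ltnSn j).
  have [guard _] := (run j.+2).2 j.+1 (ltnSn _).
  have : visited z j (z i).1 by exists i.
  move=> /cuts; rewrite /cutting_plane/= zij subrr mulmx0 mxE addr0.
  by rewrite leNgt; apply/negP/negPn; exact: guard.
(* One more iterate than there are subsets. *)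
pose f (i : 'I_#|{: {set 'I_p}}|.+1) := support1 (z i).1.
have /leq_card : injective f.
  move=> i j fij; apply/val_inj/eqP; case: ltngtP => // [/norepeat|/norepeat].
  - by rewrite -/(f i) fij.
  - by rewrite -/(f j) -fij.
by rewrite card_ord ltnn.
Qed.

(** Since the cutting planes lie below c, the point (s, c(s)) is feasible for
    every master problem.  At T = 0 the bound is only that c is
    nonnegative. *)
Lemma master_lower_bound z (T : nat) s : 0 < gamma -> sparse_cube k s1 ->
  oa_run X Y gamma k s1 T z -> sparse_cube k s ->
  (z T).2 <= cost X Y gamma s.
Proof.
move=> gamma_gt0 s1_sp run s_sp.
have s_ge0 := sparse_cube_ge0 s_sp.
case: T run => [[-> _]|T run]; first exact: cost_ge0.
have [_ [_ z_min]] := run.2 T (ltnSn T).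
apply: (z_min (s, cost X Y gamma s)); split=> //=; first exact: cost_ge0.
move=> _ [i iT ->]; apply: cutting_plane_valid => //.
by apply: sparse_cube_ge0 (iterate_feasible s1_sp run (leqW iT)).
Qed.

End OuterApproximation.

Theorem theorem4 (R : realType) (n p k : nat) (gamma : R)
    (X : 'M[R]_(n, p)) (Y : 'cV[R]_n) (s1 : 'cV[R]_p)
    (n_gt0 : (0 < n)%N) (p_gt0 : (0 < p)%N) (k_bounds : (1 <= k <= p)%N)
    (gamma_gt0 : 0 < gamma) (s1_feasible : sparse_cube k s1) :
  [/\ (* every pass can be carried out: the master problem has a minimizer *)
      forall (T : nat) (z : nat -> 'cV[R]_p * R),
        oa_run X Y gamma k s1 T z -> loop_guard X Y gamma (z T) ->
        exists z' : 'cV[R]_p * R,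
          master_solution X Y gamma k (visited z T) z',
      (* no execution makes infinitely many passes *)
      forall z : nat -> 'cV[R]_p * R,
        ~ (forall T : nat, oa_run X Y gamma k s1 T z)
    & (* whenever the loop ends, the output is optimal *)
      forall (T : nat) (z : nat -> 'cV[R]_p * R),
        oa_run X Y gamma k s1 T z -> ~ loop_guard X Y gamma (z T) ->
        is_minimizer (regression_objective X Y gamma)
          [set w : 'cV[R]_p | (norm0 w <= k)%N]
          (ridge_output X Y gamma (z T).1)].
Proof.
split; first by move=> T z _ _; exact: master_solution_exists.
  by move=> z; exact: no_infinite_run.
move=> T z run stop.
have zT_sp := iterate_feasible s1_feasible run (leqnn T).
rewrite ridge_outputE//; split=> /=.
  exact: leq_trans (norm0_primal_sol _ _ _ _) (sparse_cube_card zT_sp).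
move=> w wk; rewrite regression_primal_sol// (sparse_cube_indic zT_sp).
have w_supp j : j \notin [set j | w j 0 != 0]%SET -> w j 0 = 0.
  by rewrite inE negbK => /eqP.
apply: le_trans (regression_ge_cost X Y gamma_gt0 w_supp).
have eta_le := master_lower_bound gamma_gt0 s1_feasible run (indic_sparse R wk).
by apply: le_trans eta_le; rewrite leNgt; apply/negP.
Qed.
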